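(* For each $k$ put $n:=2^k$, let either $R_k(t):=|P_k(e^{it})|^2$ for all $k$ or $R_k(t):=|Q_k(e^{it})|^2$ for all $k$, and let $\gamma:=\sin^2(\pi/8)$. Then: (i) for every $\eta\in(0,2\gamma)$ and every $\varepsilon>0$ there is a $k_{\eta,\varepsilon}$ such that for every $k\geq k_{\eta,\varepsilon}$ the equation $R_k(t)=\eta n$ has at least $(1-\varepsilon)\eta n/2$ distinct solutions in $K$; (ii) for every $\eta\in(2-\gamma,2)$ and every $\varepsilon>0$ there is a $k_{\eta,\varepsilon}$ such that for every $k\geq k_{\eta,\varepsilon}$ the equation $R_k(t)=\eta n$ has at least $(1-\varepsilon)(2-\eta)n/2$ distinct solutions in $K$.
   Context: The Rudin-Shapiro polynomials are defined recursively by $P_0(z):=1$, $Q_0(z):=1$, and $$P_{k+1}(z):=P_k(z)+z^{2^k}Q_k(z),\qquad Q_{k+1}(z):=P_k(z)-z^{2^k}Q_k(z),\qquad k=0,1,2,\ldots.$$ Both $P_k$ and $Q_k$ have degree $n-1=2^k-1$. $K:=\mathbb{R}\ (\mathrm{mod}\ 2\pi)$. *)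

(* Defs.v *)
From mathcomp Require Import all_boot all_order all_algebra.
From mathcomp Require Import reals trigo.
From mathcomp Require Import complex.

Set Implicit Arguments.
Unset Strict Implicit.
Unset Printing Implicit Defensive.

Import Order.TTheory GRing.Theory Num.Theory.

Local Open Scope ring_scope.
Local Open Scope complex_scope.

Fixpoint rudin_shapiro (A : nzRingType) (k : nat) : {poly A} * {poly A} :=
  if k is k'.+1 then
    let: (P, Q) := rudin_shapiro A k' in
    (P + 'X^(2 ^ k') * Q, P - 'X^(2 ^ k') * Q)
  else (1, 1).

Definition rsP (A : nzRingType) (k : nat) : {poly A} := (rudin_shapiro A k).1.
Definition rsQ (A : nzRingType) (k : nat) : {poly A} := (rudin_shapiro A k).2.

Definition expi (R : realType) (t : R) : R[i] := cos t +i* sin t.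

(* The norm of R[i] takes values in R[i] (with zero imaginary part); Re brings
   its square back to R. *)
Definition sqmod_circle (R : realType) (p : {poly R[i]}) (t : R) : R :=
  complex.Re (`|p.[expi t]| ^+ 2).

Definition eq_mod2pi (R : realType) (s t : R) : Prop :=
  exists m : int, s = t + m%:~R * (2 * pi).

(* The equation f t = c, for f of period 2 pi, has at least x (a real number)
   distinct solutions in R / (2 pi Z): there are m >= x real solutions that are
   pairwise incongruent mod 2 pi. *)
Definition at_least_solutions (R : realType) (x : R) (f : R -> R) (c : R) :
    Prop :=
  exists (m : nat) (t : 'I_m -> R),
    [/\ x <= m%:R,
        forall i, f (t i) = c
      & forall i j, eq_mod2pi (t i) (t j) -> i = j].

(* Main.v *)
Require Import Defs.
From mathcomp Require Import boolp classical_sets topology normedtype sequences.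
From mathcomp Require Import all_boot all_order all_algebra.
From mathcomp Require Import reals realfun trigo.
From mathcomp Require Import complex.
From mathcomp Require Import zify ring lra.

(** Put [n = 2 ^ k] and [t_j = 2 pi j / n].

    Equidistribution: the numbers [|P_k(e^(i t_j))| ^ 2 / (2 n)] become uniformly
    distributed in [[0, 1]].  For fixed [m] the products of [m] factors [P_k] or
    [Q_k] and [m] conjugate ones, averaged over [2 ^ k t = s], are trigonometric
    polynomials in [s] with frequencies in [[-m, m]].  Passing from [k] to [k + 1]
    multiplies them by characters, keeps the even frequencies, halves these, and
    applies a Walsh transform.  The energy lost in the odd frequencies is
    summable, so these die out; the Walsh transform propagates this to all
    nonzero frequencies, and what is left at frequency zero must give the same
    mean [1 / (m + 1)] to each Bernstein monomial
    ['C(m, r) u ^ (m - r) (1 - u) ^ r].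

    Crossings: at [t_j] the value [R_k(t_j)] is [4 |P_(k-2)| ^ 2] or
    [4 |Q_(k-2)| ^ 2] according to the parity of [j], and the two add up to [2 n].
    A trigonometric polynomial of degree less than [n / 4] with values in
    [[c - M, c + M]] varies by at most [2 M sin (pi / 4)] between consecutive
    [t_j] (an interpolation formula with alternating weights at the extrema of
    [sin ((n / 4) t)]).  For [eta < 2 sin (pi / 8) ^ 2 = 1 - sin (pi / 4)] this
    excludes that [R_k(t_j)] and [R_k(t_(j+1))] are both less than [eta n].  So
    every [j] with [R_k(t_j) < eta n], asymptotically [eta n / 2] of them, gives a
    solution in [(t_j, t_(j+1)]].  Part (ii) follows from
    [|P_k| ^ 2 + |Q_k| ^ 2 = 2 n]. *)

Set Implicit Arguments.
Unset Strict Implicit.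
Unset Printing Implicit Defensive.

Import Order.TTheory GRing.Theory Num.Theory numFieldNormedType.Exports.

Local Open Scope ring_scope.
Local Open Scope complex_scope.

(** * The Walsh transform on the subsets of a finite set *)

Section Walsh.
Variables (F : comNzRingType) (J : finType).
Implicit Types (A B : {set J}) (f : {set J} -> F).

Definition walsh A B : F := \prod_j (-1) ^+ ((j \in A) && (j \in B)).

(** The sum over [A] is a product over [j] of factors [1 + (-1)^([j in B] + [j in C])], and such a
    factor is 0 wherever [B] and [C] differ. *)
Lemma walsh_orthogonal B C :
  \sum_A walsh A B * walsh A C = 2 ^+ #|J| *+ (B == C).
Proof.
under eq_bigr => A _ do rewrite /walsh -big_split /=.
transitivity (\sum_(A : {set J}) \prod_j
    (if j \in A then (-1) ^+ (j \in B) * (-1) ^+ (j \in C) else 1 : F)).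
  by apply: eq_bigr => A _; apply: eq_bigr => j _; case: (j \in A);
     rewrite //= mulr1.
rewrite -bigA_distr; have [<-|] := eqVneq B C.
  under eq_bigr => j _ do rewrite -expr2 -exprM mulnC exprM sqrrN expr1n expr1n.
  by rewrite -[RHS](prodr_const (pred_of_simpl (predT : simpl_pred J)) (2 : F)).
move=> neqBC; have [j Hj] : exists j, (j \in B) != (j \in C).
  apply/existsP; rewrite -negb_forall; apply: contraNN neqBC => /forallP h.
  by apply/eqP/setP => j; apply/eqP.
rewrite (bigD1 j) //= mulr0n.
by move: Hj; case: (j \in B); case: (j \in C) => // _;
   rewrite ?mulr1 ?mul1r expr1 addNr mul0r.
Qed.

Lemma walsh_inversion f B :
  \sum_A walsh A B * (\sum_C walsh A C * f C) = 2 ^+ #|J| * f B.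
Proof.
under eq_bigr => A _ do rewrite mulr_sumr.
rewrite exchange_big /= (bigD1 B) //= [X in _ + X]big1 ?addr0 => [|C neqCB].
  under eq_bigr => A _ do rewrite mulrA.
  by rewrite -mulr_suml walsh_orthogonal eqxx mulr1n.
under eq_bigr => A _ do rewrite mulrA.
by rewrite -mulr_suml walsh_orthogonal eq_sym (negPf neqCB) mulr0n mul0r.
Qed.

Lemma walsh_parseval f :
  \sum_A (\sum_B walsh A B * f B) ^+ 2 = 2 ^+ #|J| * \sum_B f B ^+ 2.
Proof.
rewrite mulr_sumr.
transitivity (\sum_A \sum_B f B * (walsh A B * \sum_C walsh A C * f C)).
  apply: eq_bigr => A _; rewrite expr2 mulr_suml.
  by apply: eq_bigr => B _; ring.
rewrite exchange_big /=; apply: eq_bigr => B _.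
by rewrite -mulr_sumr walsh_inversion expr2; ring.
Qed.

Lemma walsh_setC A B : walsh A (~: B) = walsh A B * (-1) ^+ #|A|.
Proof.
rewrite -sum1_card big_mkcond /= -prodrXr -big_split /=.
apply: eq_bigr => j _; rewrite inE.
by case: (j \in A); case: (j \in B); rewrite /= ?expr0 ?expr1 ?mulrNN ?mulr1 ?mul1r.
Qed.

End Walsh.

(** * Recursion for the Fourier coefficients of the moments *)

Section MomentPoly.
Variables (F : fieldType) (m : nat).
Local Notation J := ('I_m + 'I_m)%type.
Implicit Types (A B : {set J}).

Definition right_side (j : J) : bool := if j is inr _ then true else false.

(* Multiplying by [z ^ N] in the factors [j \in B], conjugated on the right
   copy of ['I_m], produces [z ^ (N * (twist B - m))]. *)
Definition twist B : nat := \sum_j ((j \in B) (+) right_side j).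

(* The coefficient of [X ^ f] in [moment_poly k B] is that of [z ^ ((f - m) 2^k)]
   in the normalised product of the factors [P_k] ([j \notin B]) and [Q_k]
   ([j \in B]), conjugated on the right copy of ['I_m]. *)
Fixpoint moment_poly (k : nat) (A : {set J}) : {poly F} :=
  if k is k'.+1 then
    (2 ^- m) *: \sum_B walsh F A B *: even_poly ('X^(twist B) * moment_poly k' B)
  else (2 ^- m) *: 'X^m.

Definition moment_coef k B f : F := (moment_poly k B)`_f.

(** The coefficients after multiplication by the characters, before the odd frequencies are dropped
    and the even ones halved. *)
Definition twisted_coef k B f : F := ('X^(twist B) * moment_poly k B)`_f.

Lemma twisted_coefE k B f :
  twisted_coef k B f = if (f < twist B)%N then 0 else moment_coef k B (f - twist B).
Proof. exact: coefXnM. Qed.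

Lemma moment_coef0 B f : moment_coef 0 B f = 2 ^- m * (f == m)%:R.
Proof. by rewrite /moment_coef /= coefZ coefXn. Qed.

Lemma moment_coefS k A g :
  moment_coef k.+1 A g = 2 ^- m * \sum_B walsh F A B * twisted_coef k B g.*2.
Proof.
rewrite /moment_coef /= coefZ coef_sum; congr (_ * _).
by apply: eq_bigr => B _; rewrite coefZ coef_even_poly.
Qed.

Lemma twist_setC B : (twist B + twist (~: B) = m.*2)%N.
Proof.
rewrite /twist -big_split /= (eq_bigr (fun=> 1%N)) => [|j _].
  by rewrite sum1_card card_sum card_ord addnn.
by rewrite inE; case: (j \in B); case: (right_side j).
Qed.

Lemma twist_le B : (twist B <= m.*2)%N.
Proof. by rewrite -(twist_setC B) leq_addr. Qed.

(** Modulo 2 the indicators of [B] and of the right copy, which has [m] elements, simply add. This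
    ties the parity of frequencies to the sign [(-1)^|A|] that complementation produces in the Walsh
    transform. *)
Lemma odd_twist B : odd (twist B) = odd #|B| (+) odd m.
Proof.
have odd_sum (D : {set J}) : odd #|D| = \big[addb/false]_j (j \in D).
  rewrite -sum1_card big_mkcond (big_morph odd oddD (erefl : odd 0 = false)) /=.
  by apply: eq_bigr => j _; case: (j \in D).
have -> : odd m = odd #|[set j : J | right_side j]|.
  congr odd; rewrite -sum1_card big_sumType /= big_pred0 => [|i]; last by rewrite inE.
  by rewrite (eq_bigl predT) ?sum1_card ?card_ord // => i; rewrite inE.
rewrite /twist (big_morph odd oddD (erefl : odd 0 = false)) !odd_sum -big_split.
by apply: eq_bigr => j _; rewrite inE oddb.
Qed.

(** Multiplication by [X^(twist B)] adds at most [2m] to the degree and the even part halves it, so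
    the bound [2m] reproduces itself. *)
Lemma moment_coef_large k B f : (m.*2 < f)%N -> moment_coef k B f = 0.
Proof.
elim: k B f => [|k IH] B f lt_f.
  by rewrite moment_coef0 gtn_eqF ?mulr0 //; lia.
rewrite moment_coefS big1 ?mulr0 // => C _; rewrite twisted_coefE ltnNge.
have leC := twist_le C; rewrite (_ : _ <= _)%N /=; last by lia.
by rewrite IH ?mulr0 //; lia.
Qed.

Hypothesis nz2 : 2 != 0 :> F.

Lemma moment_coefS_inversion k B g :
  \sum_A walsh F A B * moment_coef k.+1 A g = 2 ^+ m * twisted_coef k B g.*2.
Proof.
under eq_bigr => A _ do rewrite moment_coefS mulrCA.
rewrite -mulr_sumr walsh_inversion mulrA card_sum card_ord exprD mulrA.
by rewrite mulVf ?mul1r // expf_neq0.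
Qed.

Definition moment_energy k : F := \sum_B \sum_(f < (m.*2).+1) moment_coef k B f ^+ 2.

(** By Parseval the Walsh transform on [2^(2m)] sets, scaled by [2^-m], preserves the energy of the
    even coefficients; exactly the odd ones are lost. *)
Lemma moment_energyS k : moment_energy k = moment_energy k.+1 +
  \sum_B \sum_(g < (m.*2).+1) twisted_coef k B g.*2.+1 ^+ 2.
Proof.
have -> : moment_energy k.+1 =
    \sum_B \sum_(g < (m.*2).+1) twisted_coef k B g.*2 ^+ 2.
  rewrite /moment_energy exchange_big [RHS]exchange_big /=.
  apply: eq_bigr => g _; under eq_bigr => A _ do rewrite moment_coefS exprMn.
  rewrite -mulr_sumr walsh_parseval mulrA card_sum card_ord exprVn -exprM.
  by rewrite (_ : m * 2 = m + m)%N ?muln2 ?addnn // mulVf ?mul1r // expf_neq0.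
rewrite /moment_energy -big_split /=; apply: eq_bigr => B _.
(* After a shift by [twist B <= 2m] all nonzero coefficients sit below [4m + 2], a range that splits
   equally into even and odd indices. *)
rewrite -big_split /=; transitivity (\sum_(f < (m.*2).+1.*2) twisted_coef k B f ^+ 2).
  have leB := twist_le B.
  rewrite -(big_mkord xpredT (fun f => twisted_coef k B f ^+ 2)).
  rewrite (big_cat_nat _ (n := twist B)) //=; last by lia.
  have -> : \sum_(0 <= f < twist B) twisted_coef k B f ^+ 2 = 0.
    rewrite big_nat big1 // => f /andP[_ ltf].
    by rewrite twisted_coefE ltf expr0n.
  rewrite add0r -{1}[twist B]add0n big_addn (big_cat_nat _ (n := (m.*2).+1)) //=; last by lia.
  rewrite [X in _ = _ + X]big_nat [X in _ = _ + X]big1 ?addr0 => [|f /andP[ltf _]]; last first.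
    by rewrite twisted_coefE ltnNge leq_addl /= addnK moment_coef_large ?expr0n.
  rewrite big_mkord; apply: eq_bigr => f _.
  by rewrite twisted_coefE ltnNge leq_addl /= addnK.
elim: (m.*2.+1) => [|p IH]; first by rewrite !big_ord0.
by rewrite doubleS !big_ord_recr /= IH addrA.
Qed.

End MomentPoly.

(** * Sequences tending to zero *)

Section Null.
Variable R : realType.
Implicit Types u v : nat -> R.

Definition null u : Prop := (u @ \oo --> (0 : R))%classic.

Lemma eq_null u v : u =1 v -> null u -> null v.
Proof. by move=> /funext ->. Qed.

Lemma nullD u v : null u -> null v -> null (fun n => u n + v n).
Proof. by move=> hu hv; rewrite /null -(addr0 (0 : R)); apply: cvgD. Qed.

Lemma nullM c u : null u -> null (fun n => c * u n).
Proof. by move=> hu; rewrite /null -(mulr0 c); apply: cvgMl_tmp. Qed.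

Lemma nullMrV c u : c != 0 -> null (fun n => c * u n) -> null u.
Proof.
by move=> c0 /(nullM c^-1); apply: eq_null => n; rewrite mulrA mulVf ?mul1r.
Qed.

Lemma nullN u : null u -> null (fun n => - u n).
Proof. by move=> /(nullM (-1)); apply: eq_null => n; rewrite mulN1r. Qed.

Lemma nullB u v : null u -> null v -> null (fun n => u n - v n).
Proof. by move=> hu /nullN; apply: nullD. Qed.

Lemma null_shift u : null (fun n => u n.+1) -> null u.
Proof. by rewrite /null -(cvg_shiftS u). Qed.

Lemma null_const0 : null (fun=> 0).
Proof. exact: cvg_cst. Qed.

Lemma null_sum (I : finType) (P : pred I) (f : I -> nat -> R) :
  (forall i, P i -> null (f i)) -> null (fun n => \sum_(i | P i) f i n).
Proof.
move=> nf; elim: (index_enum I) => [|i r IH].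
  by apply: eq_null null_const0 => n; rewrite big_nil.
apply: (@eq_null (fun n => (if P i then f i n else 0) + \sum_(j <- r | P j) f j n)).
  by move=> n; rewrite big_cons; case: (P i); rewrite ?add0r.
by apply: nullD => //; case: (boolP (P i)) => [/nf //|_]; exact: null_const0.
Qed.

Lemma null_drop u : (forall n, u n.+1 <= u n) -> (forall n, 0 <= u n) ->
  null (fun n => u n - u n.+1).
Proof.
move=> dec pos; have /cvg_ex[l hl] : cvgn u.
  apply: nonincreasing_is_cvgn; first by apply/nonincreasing_seqP.
  by exists 0 => _ [n _ <-].
rewrite /null -(subrr l); apply: cvgB => //.
by rewrite (cvg_shiftS u).
Qed.

Lemma null_sqr_le u v : (forall n, u n ^+ 2 <= v n) -> null v -> null u.
Proof.
move=> le_uv /cvgr0_norm_lt hv; apply/cvgr0Pnorm_lt => e e0.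
have := hv (e ^+ 2) (exprn_gt0 _ e0); apply: filterS => n.
move=> /(le_lt_trans (ler_norm _)) /(le_lt_trans (le_uv n)).
by rewrite -real_normK ?num_real // ltr_pXn2r // nnegrE ltW.
Qed.

End Null.

(** * Decay of the coefficients away from frequency zero *)

Section MomentConcentration.
Variables (R : realType) (m : nat).
Local Notation J := ('I_m + 'I_m)%type.
Implicit Types (A B : {set J}).
Local Notation w B f := (fun k => moment_coef R k (B : {set J}) f).
Local Notation y B f := (fun k => twisted_coef R k (B : {set J}) f).

Let nz2 : 2 != 0 :> R. Proof. by rewrite pnatr_eq0. Qed.
Let nz2m : 2 ^+ m != 0 :> R. Proof. by rewrite expf_neq0. Qed.

(** The energy is nonnegative and nonincreasing, hence converges; its loss in one step, which
    dominates the square of each odd coefficient, therefore tends to 0. *)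
Lemma null_odd_twisted B g : null (y B g.*2.+1).
Proof.
have [ltg|leg] := ltnP g (m.*2).+1; last first.
  apply: eq_null (@null_const0 R) => k; rewrite twisted_coefE.
  have leB := twist_le B; rewrite ltnNge (_ : twist B <= _)%N /=; last by lia.
  by rewrite moment_coef_large //; lia.
pose e k := moment_energy R m k.
have e0 k : 0 <= e k by do 2!apply: sumr_ge0 => ? _; apply: sqr_ge0.
pose o k B := \sum_(g < (m.*2).+1) twisted_coef R k B g.*2.+1 ^+ 2.
have o0 k C : 0 <= o k C by apply: sumr_ge0 => ? _; apply: sqr_ge0.
have eS k : e k = e k.+1 + \sum_B o k B by exact: moment_energyS.
apply: (@null_sqr_le _ _ (fun k => e k - e k.+1)); last first.
  apply: null_drop => // k; rewrite [leRHS]eS lerDl.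
  by apply: sumr_ge0.
move=> k; rewrite {1}eS addrAC subrr add0r (bigD1 B) //=.
rewrite /o (bigD1 (Ordinal ltg)) //= -!addrA lerDl addr_ge0 //.
  by apply: sumr_ge0 => ? _; apply: sqr_ge0.
by apply: sumr_ge0 => C _; exact: o0.
Qed.

Lemma null_odd B f : odd (f + twist B) -> null (w B f).
Proof.
move=> odd_f; have := null_odd_twisted B ((f + twist B)./2).
rewrite (_ : _./2.*2.+1 = f + twist B)%N; last first.
  by rewrite -[RHS]odd_double_half odd_f.
by apply: eq_null => k; rewrite twisted_coefE ltnNge leq_addl /= addnK.
Qed.

(* The coefficients [moment_coef k.+1 A g] with [g + twist A] odd vanish in the
   limit, so the Walsh transform is supported on one parity class of [#|A|],
   i.e. symmetric or antisymmetric under complementation. *)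
Lemma null_twisted_setC B g :
  null (y (~: B) g.*2) -> null (y B g.*2).
Proof.
(* The sign makes [s (-1)^|A|] equal to [(-1)^(g + twist A)]. In the Walsh expansion of the
   difference, each term then has either a zero factor or a coefficient of odd parity, which is
   null. *)
move=> nC; pose s : R := (-1) ^+ (g + m).
have -> : y B g.*2 = fun k => s * twisted_coef R k (~: B) g.*2 +
   (twisted_coef R k B g.*2 - s * twisted_coef R k (~: B) g.*2).
  by apply/funext => k; rewrite addrC subrK.
apply: nullD; first exact: nullM.
apply: (@nullMrV _ (2 ^+ m)) => //.
apply: (@eq_null _ (fun k => \sum_A walsh R A B * (1 - (-1) ^+ (g + twist A)) *
          moment_coef R k.+1 A g)) => [k|].
  rewrite mulrBr [in RHS]mulrCA -!moment_coefS_inversion // mulr_sumr -sumrB.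
  apply: eq_bigr => A _; rewrite walsh_setC -signr_odd oddD odd_twist signr_addb.
  rewrite [X in 1 - _ * X]signr_addb !signr_odd /s exprD; ring.
apply: null_sum => A _; have [odd_g|even_g] := boolP (odd (g + twist A)).
  apply: nullM; have /= := null_odd odd_g.
  by rewrite /null -[X in X -> _](cvg_shiftS (w A g)).
apply: eq_null (@null_const0 R) => k.
by rewrite -signr_odd (negPf even_g) subrr mulr0 mul0r.
Qed.

Lemma null_moment_coefS A g : (forall B, null (y B g.*2)) -> null (w A g).
Proof.
move=> ny; apply: null_shift.
apply: (@eq_null _ (fun k => 2 ^- m * \sum_B walsh R A B * twisted_coef R k B g.*2)).
  by move=> k; rewrite moment_coefS.
by apply/nullM/null_sum => B _; apply/nullM.
Qed.

Lemma null_twisted B g : (forall A, null (w A g)) -> null (y B g.*2).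
Proof.
move=> nw; apply: (@nullMrV _ (2 ^+ m)) => //.
apply: (@eq_null _ (fun k => \sum_A walsh R A B * moment_coef R k.+1 A g)).
  by move=> k; rewrite moment_coefS_inversion.
apply: null_sum => A _; apply: nullM.
by have := nw A; rewrite /null -[X in X -> _](cvg_shiftS (w A g)).
Qed.

(* The frequencies [f], [f'] of [y B g.*2] and [y (~: B) g.*2] satisfy
   [(f - m) + (f' - m) = 4 (g - m)], so one of them is at least twice as far
   from [m] as [g]. *)
Lemma null_far_coef j B f :
  (m < ((f - m) + (m - f)) * 2 ^ j)%N -> null (w B f).
Proof.
elim: j B f => [|j IH] B g.
  (* Since [m - f <= m], a distance greater than [m] forces [f > 2m], beyond the degree. *)
  rewrite muln1 => /= far; apply: eq_null (@null_const0 R) => k.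
  by rewrite moment_coef_large //; lia.
rewrite expnS; set X := (2 ^ j)%N in IH * => far.
apply: null_moment_coefS => {}B.
have one_of C : (g.*2 < twist C)%N \/
    (m < ((g.*2 - twist C - m) + (m - (g.*2 - twist C))) * X)%N ->
    null (y C g.*2).
  case=> [lt|farC]; first by apply: eq_null (@null_const0 R) => k; rewrite twisted_coefE lt.
  have [lt|le] := ltnP g.*2 (twist C).
    by apply: eq_null (@null_const0 R) => k; rewrite twisted_coefE lt.
  apply: eq_null (IH C _ farC) => k.
  by rewrite twisted_coefE ltnNge le.
have BC := twist_setC B.
suff [|] : ((g.*2 < twist B)%N \/
    (m < ((g.*2 - twist B - m) + (m - (g.*2 - twist B))) * X)%N) \/
  ((g.*2 < twist (~: B))%N \/
    (m < ((g.*2 - twist (~: B) - m) + (m - (g.*2 - twist (~: B)))) * X)%N).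
- exact: one_of.
- by move=> /one_of; exact: null_twisted_setC.
have [ltB|leB] := ltnP g.*2 (twist B); first by left; left.
have [ltC|leC] := ltnP g.*2 (twist (~: B)); first by right; left.
set p := (g.*2 - twist B - m + (m - (g.*2 - twist B)))%N.
set q := (g.*2 - twist (~: B) - m + (m - (g.*2 - twist (~: B))))%N.
have : (2 * ((g - m + (m - g)) * 2) <= p + q)%N by lia.
have [ltp|lep] := ltnP m (p * X); first by left; right.
move=> le2; right; right; nia.
Qed.

Lemma null_off_center B f : f != m -> null (w B f).
Proof.
move=> nefm; apply: (@null_far_coef m).
apply: leq_trans (ltn_expl m (isT : 1 < 2)%N) _.
by rewrite leq_pmull //; lia.
Qed.

(** The central coefficient of [B] sits at index [m + twist B] after the twist. If this is even,
    inversion expresses it by coefficients at [(m + twist B) / 2], which is not the centre. *)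
Lemma null_unbalanced B : twist B != m -> null (w B m).
Proof.
move=> neB; have [odd_m|even_m] := boolP (odd (m + twist B)); first exact: null_odd.
have eg : ((m + twist B)./2.*2 = m + twist B)%N.
  by rewrite -[RHS]odd_double_half (negPf even_m).
have /(null_twisted B) : forall A, null (w A (m + twist B)./2).
  by move=> A; apply: null_off_center; lia.
rewrite eg; apply: eq_null => k.
by rewrite twisted_coefE ltnNge leq_addl /= addnK.
Qed.

(** For unbalanced [A] the next central coefficient is null, and it is the Walsh sum of the twisted
    coefficients at [2m]. Those with [twist B != m] come from off the centre, so the balanced ones
    must cancel among themselves. *)
Lemma null_walsh_center A : twist A != m ->
  null (fun k => \sum_(B : {set J} | twist B == m) walsh R A B * moment_coef R k B m).
Proof.
move=> neA.
have -> : (fun k => \sum_(B : {set J} | twist B == m) walsh R A B * moment_coef R k B m) =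
  fun k => 2 ^+ m * moment_coef R k.+1 A m -
    \sum_(B : {set J} | twist B != m) walsh R A B * twisted_coef R k B m.*2.
  apply/funext => k; rewrite moment_coefS mulrA mulfV // mul1r.
  rewrite [in RHS](bigID (fun B => twist B == m)) /= addrK.
  apply: eq_bigr => B /eqP eB; rewrite twisted_coefE eB -addnn ltnNge leq_addl /=.
  by rewrite addnK.
apply: nullB.
  apply: nullM; have := null_unbalanced neA.
  by rewrite /null -[X in X -> _](cvg_shiftS (w A m)).
apply: null_sum => B neB; apply: nullM.
have leB := twist_le B.
have /(@null_off_center B) : (m.*2 - twist B)%N != m by lia.
by apply: eq_null => k; rewrite twisted_coefE ltnNge leB.
Qed.

End MomentConcentration.

(** * Equality of the limits of the Bernstein moments *)

Section BinomialCvg.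
Variables (R : realType) (m : nat).
Local Notation J := ('I_m + 'I_m)%type.
Implicit Types (K L : {set 'I_m}).

Definition set_sum K L : {set J} :=
  [set j : J | match j with inl i => i \in K | inr i => i \in L end]%SET.

Lemma twist_set_sum K L : twist (set_sum K L) = (#|K| + #|~: L|)%N.
Proof.
rewrite /twist big_sumType /= -!sum1_card; congr (_ + _)%N.
  by rewrite [RHS]big_mkcond; apply: eq_bigr => i _; rewrite inE addbF; case: (_ \in _).
by rewrite [RHS]big_mkcond; apply: eq_bigr => i _; rewrite !inE addbT; case: (_ \in _).
Qed.

Lemma twist_set_sum_eq K L : (twist (set_sum K L) == m) = (#|L| == #|K|).
Proof.
by rewrite twist_set_sum; have := cardsC L; rewrite card_ord; lia.
Qed.

Lemma big_set_sum (P : pred {set J}) (F : {set J} -> R) :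
  \sum_(B | P B) F B = \sum_K \sum_(L : {set 'I_m} | P (set_sum K L)) F (set_sum K L).
Proof.
rewrite pair_big_dep /= (reindex (fun p => set_sum p.1 p.2)) //=.
exists (fun B : {set J} => (inl @^-1: B, inr @^-1: B)) => [[K L] _|B _] /=.
  by congr pair; apply/setP => i; rewrite !inE.
by apply/setP => -[i|i]; rewrite !inE.
Qed.

Lemma walsh_set_sum0 A K L : walsh R (set_sum A set0) (set_sum K L) = walsh R A K.
Proof.
rewrite /walsh big_sumType /= [X in _ * X]big1 ?mulr1 => [|i _]; last by rewrite !inE.
by apply: eq_bigr => i _; rewrite !inE.
Qed.

Lemma card_sets_of_card r : #|[pred L : {set 'I_m} | #|L| == r]| = 'C(m, r).
Proof.
have := card_draws 'I_m r; rewrite card_ord => <-.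
by apply: eq_card => L; rewrite !inE.
Qed.

(** [G k r] will be the grid mean of [u^(m - r) (1 - u)^r] for [u = |P_k|^2 / (2n)]: a balanced
    product depends only on the number [r] of factors [Q_k]. *)
Variable G : nat -> nat -> R.
Hypothesis cvgG : forall K L, #|L| = #|K| ->
  null (fun k => moment_coef R k (set_sum K L) m - G k #|K|).

(** The index [set_sum A set0] is unbalanced and its character ignores [L], so each [K] is counted
    once for every [L] of the same size. *)
Lemma null_walsh_binomial A : A != set0 ->
  null (fun k => \sum_(L : {set 'I_m}) walsh R A L * ('C(m, #|L|)%:R * G k #|L|)).
Proof.
move=> neA0; have neA : twist (set_sum A set0) != m.
  by rewrite twist_set_sum_eq cards0 eq_sym cards_eq0.
have n1 := null_walsh_center (R := R) neA.
have : null (fun k => \sum_(K : {set 'I_m}) \sum_(L : {set 'I_m} | #|L| == #|K|) walsh R A K *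
   (moment_coef R k (set_sum K L) m - G k #|K|)).
  by do 2!apply: null_sum => ? ?; apply/nullM/cvgG/eqP.
move=> /(nullB n1); apply: eq_null => k.
rewrite big_set_sum -sumrB; apply: eq_bigr => K _.
rewrite (eq_bigl (fun L : {set 'I_m} => #|L| == #|K|)) => [|L]; last exact: twist_set_sum_eq.
rewrite -sumrB (eq_bigr (fun=> walsh R A K * G k #|K|)) => [|L _].
  by rewrite sumr_const card_sets_of_card -[LHS]mulr_natl mulrCA.
by rewrite walsh_set_sum0; ring.
Qed.

(** All nontrivial Walsh coefficients of [K |-> 'C(m, #|K|) G k #|K|] tend to 0, so by inversion
    this function is asymptotically constant. *)
Lemma null_binomial_diff r s : (r <= m)%N -> (s <= m)%N ->
  null (fun k => 'C(m, r)%:R * G k r - 'C(m, s)%:R * G k s).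
Proof.
have ex_set p : (p <= m)%N -> exists K : {set 'I_m}, #|K| = p.
  rewrite -bin_gt0 -card_sets_of_card => /card_gt0P[K].
  by rewrite inE => /eqP; exists K.
move=> /ex_set[K <-] /ex_set[L <-].
apply: (@nullMrV _ (2 ^+ m)); first by rewrite expf_neq0 // pnatr_eq0.
pose H k (M : {set 'I_m}) : R := 'C(m, #|M|)%:R * G k #|M|.
apply: (@eq_null _ (fun k => \sum_(A : {set 'I_m} | A != set0)
    (walsh R A K - walsh R A L) * \sum_(M : {set 'I_m}) walsh R A M * H k M)) => [k|].
  have inv M := walsh_inversion (H k) M; rewrite card_ord in inv.
  rewrite mulrBr -[X in _ = X - _]inv -[X in _ = _ - X]inv -sumrB.
  have w0 M : walsh R (set0 : {set 'I_m}) M = 1.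
    by rewrite /walsh big1 // => i _; rewrite inE.
  rewrite [RHS](bigD1 set0) //= !w0 subrr add0r.
  by apply: eq_bigr => A _; rewrite mulrBl.
by apply: null_sum => A neA; apply/nullM/null_walsh_binomial.
Qed.

Hypothesis sumG : forall k, \sum_(r < m.+1) 'C(m, r)%:R * G k r = 1.

Lemma binomial_cvg r : (r <= m)%N ->
  null (fun k => 'C(m, r)%:R * G k r - m.+1%:R^-1).
Proof.
move=> ler; have nz : m.+1%:R != 0 :> R by rewrite pnatr_eq0.
apply: (nullMrV nz).
apply: (@eq_null _ (fun k => \sum_(s < m.+1) ('C(m, r)%:R * G k r - 'C(m, s)%:R * G k s))).
  move=> k; rewrite sumrB sumG sumr_const card_ord mulrBr mulfV //.
  by rewrite [X in _ = X - _]mulr_natl.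
by apply: null_sum => s _; apply: null_binomial_diff => //; rewrite -ltnS.
Qed.

End BinomialCvg.

(** * Sums of products over shifted grids *)

Section GridAverage.
Variable R : realType.
Local Notation C := R[i].
Implicit Types (s t : R) (k m : nat).

Lemma expiD s t : expi (s + t) = expi s * expi t.
Proof. by rewrite /expi cosD sinD; simpc; congr (_ +i* _); rewrite addrC. Qed.

Lemma expi0 : expi (0 : R) = 1.
Proof. by rewrite /expi cos0 sin0. Qed.

Lemma expiMn n t : expi (t *+ n) = expi t ^+ n.
Proof.
elim: n => [|n IH]; first by rewrite mulr0n expi0.
by rewrite mulrS expiD IH exprS.
Qed.

Lemma expi_conj t : (expi t)^*%C = expi (- t).
Proof. by rewrite /expi cosN sinN. Qed.

Lemma expi_conjM t : (expi t)^*%C * expi t = 1.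
Proof. by rewrite expi_conj -expiD addNr expi0. Qed.

Lemma expi_pi : expi (pi : R) = -1.
Proof. by rewrite /expi cospi sinpi; apply/eqP; rewrite eq_complex /= oppr0 !eqxx. Qed.

Lemma expi_2piMn n : expi (2 * pi *+ n : R) = 1.
Proof. by rewrite expiMn mulr_natl expiMn expi_pi sqrrN expr1n expr1n. Qed.

Lemma sqmod_circleE (p : {poly C}) t :
  (sqmod_circle p t)%:C = p.[expi t] * (p.[expi t])^*%C.
Proof.
rewrite /sqmod_circle normCK RRe_real // -normCK.
by rewrite rpredX // normr_real.
Qed.

Lemma rsPS (A : nzRingType) k : rsP A k.+1 = rsP A k + 'X^(2 ^ k) * rsQ A k.
Proof. by rewrite /rsP /rsQ /=; case: rudin_shapiro. Qed.

Lemma rsQS (A : nzRingType) k : rsQ A k.+1 = rsP A k - 'X^(2 ^ k) * rsQ A k.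
Proof. by rewrite /rsP /rsQ /=; case: rudin_shapiro. Qed.

Definition rs_val k (b : bool) t : C :=
  if b then (rsQ C k).[expi t] else (rsP C k).[expi t].

Lemma rs_valS k (b : bool) t : rs_val k.+1 b t =
  (-1) ^+ b * (expi t ^+ (2 ^ k) * rs_val k true t) + rs_val k false t.
Proof.
rewrite /rs_val rsPS rsQS; case: b; rewrite !hornerE ?hornerXn /= addrC //.
by rewrite expr1 mulN1r mulNr.
Qed.

Section Product.
Variable m : nat.
Local Notation J := ('I_m + 'I_m)%type.
Implicit Types (A B : {set J}) (j : J).

Definition side_conj j (z : C) : C := if right_side j then z^*%C else z.

Definition rs_prod k B t : C := \prod_j side_conj j (rs_val k (j \in B) t).

(** The factor [z^(2^k m)] gives one [e] to each right factor, where it cancels the conjugate of [e]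
    before [Q_k] and survives before [P_k]. Hence [twist] counts the right indices outside [B]. *)
Lemma rs_prodS k A t : expi t ^+ (2 ^ k * m) * rs_prod k.+1 A t =
  \sum_B walsh C A B * (expi t ^+ (2 ^ k * twist B) * rs_prod k B t).
Proof.
set e := expi t ^+ (2 ^ k).
have e1 : e^*%C * e = 1 by rewrite /e rmorphXn -exprMn expi_conjM expr1n.
have em : expi t ^+ (2 ^ k * m) = \prod_(j : J) (if right_side j then e else 1).
  rewrite exprM -/e big_sumType /= big1 // mul1r prodr_const card_ord //.
rewrite em /rs_prod; under [X in _ * X]eq_bigr => j _.
  rewrite rs_valS (_ : side_conj j _ =
    (-1) ^+ (j \in A) * side_conj j e * side_conj j (rs_val k true t) +
    side_conj j (rs_val k false t)); last first.
    rewrite /side_conj; case: (right_side j); last by rewrite mulrA.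
    by rewrite rmorphD !rmorphM rmorphXn rmorphN1 mulrA.
  over.
rewrite bigA_distr mulr_sumr; apply: eq_bigr => B _.
rewrite exprM -/e /twist -prodrXr /walsh -!big_split /=.
apply: eq_bigr => j _; rewrite /side_conj.
case: (j \in B); case: (j \in A); case: (right_side j);
  rewrite /= ?expr0 ?expr1 ?mul1r ?mulr1 ?mulN1r ?mulrN //.
- by rewrite mulNr mulrN mulrA [e * _]mulrC e1 mul1r.
- by rewrite mulNr.
- by rewrite mulrA [e * _]mulrC e1 mul1r.
Qed.

(** The points are the solutions of [2^k t = s] modulo [2 pi]. *)
Definition grid_sum k (f : R -> C) s : C :=
  \sum_(j < 2 ^ k) f ((s + 2 * pi *+ j) / (2 ^ k)%:R).

Lemma grid_sumS k f s :
  grid_sum k.+1 f s = grid_sum k f (s / 2) + grid_sum k f (s / 2 + pi).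
Proof.
rewrite /grid_sum expnS mul2n.
have nz : (2 ^ k)%:R != 0 :> R by rewrite pnatr_eq0 expn_eq0.
transitivity (\sum_(j < 2 ^ k) (f ((s + 2 * pi *+ j.*2) / (2 ^ k).*2%:R) +
                                f ((s + 2 * pi *+ j.*2.+1) / (2 ^ k).*2%:R))).
  elim: (2 ^ k)%N (2 ^ k).*2%:R => [|n IH] x; first by rewrite !big_ord0.
  by rewrite doubleS !big_ord_recr /= IH addrA.
rewrite -big_split /=; apply: eq_bigr => j _; congr (f _ + f _).
  by rewrite -!(mulr_natl (2 * pi)) -!mul2n !natrM; field.
by rewrite -!(mulr_natl (2 * pi)) -!mul2n -addn1 natrD !natrM; field.
Qed.

Lemma even_polyE (p : {poly C}) z :
  p.[z] + p.[- z] = 2 * (even_poly p).[z ^+ 2].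
Proof.
rewrite -{1 2}(poly_even_odd p) !hornerD !hornerM !hornerX !horner_comp !hornerXn sqrrN.
ring.
Qed.

(** The two half grids have opposite values of [z^(2^k)], so adding them keeps the even powers. The
    power of 2 collects the [2^k] grid points and the normalisation [(|P_k|^2 + |Q_k|^2)^m]. *)
Lemma grid_sum_rs_prod k B s : expi s ^+ m * grid_sum k (rs_prod k B) s =
  2 ^+ (k + k.+1 * m) * (moment_poly C k B).[expi s].
Proof.
elim: k B s => [|k IH] A s.
  rewrite /grid_sum expn0 big_ord1 /rs_prod big1 => [|j _]; last first.
    rewrite /rs_val /rsP /rsQ /= hornerC if_same /side_conj.
    by case: right_side; rewrite ?rmorph1.
  rewrite add0n mul1n /= hornerZ hornerXn mulr1 mulrA mulfV ?mul1r //.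
  by rewrite expf_neq0 ?pnatr_eq0.
have half s' : expi s' ^+ (2 * m) * grid_sum k (rs_prod k.+1 A) s' =
    2 ^+ (k + k.+1 * m) *
      \sum_B walsh C A B * ('X^(twist B) * moment_poly C k B).[expi s'].
  rewrite mul2n -addnn exprD -mulrA.
  have -> : expi s' ^+ m * grid_sum k (rs_prod k.+1 A) s' =
      \sum_B walsh C A B * (expi s' ^+ twist B * grid_sum k (rs_prod k B) s').
    rewrite mulr_sumr (eq_bigr (fun j : 'I_(2 ^ k) => \sum_B walsh C A B *
      (expi s' ^+ twist B * rs_prod k B ((s' + 2 * pi *+ j) / (2 ^ k)%:R)))).
      by rewrite exchange_big; apply: eq_bigr => B _; rewrite -!mulr_sumr.
    move=> j _; set t := _ / _.
    (* [z^(2^k)] is the same at all points of the grid, so the recursion can be summed with constant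
       coefficients. *)
    have <- : expi t ^+ (2 ^ k) = expi s'.
      rewrite -expiMn -mulr_natr mulfVK ?pnatr_eq0 ?expn_eq0 //.
      by rewrite expiD expi_2piMn mulr1.
    rewrite -exprM rs_prodS; apply: eq_bigr => B _; by rewrite -exprM.
  rewrite !mulr_sumr; apply: eq_bigr => B _.
  rewrite hornerM hornerXn; move: (IH B s') => /= IHB.
  transitivity (walsh C A B * (expi s' ^+ twist B *
    (expi s' ^+ m * grid_sum k (rs_prod k B) s'))); first by ring.
  by rewrite IHB; ring.
have es1 : expi s = expi (s / 2) ^+ 2 by rewrite -expiMn -[_ / 2 *+ 2]mulr_natr mulfVK ?pnatr_eq0.
have es2 : expi (s / 2 + pi) = - expi (s / 2) by rewrite expiD expi_pi mulrN1.
have es : expi s = expi (s / 2 + pi) ^+ 2 by rewrite es2 sqrrN.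
rewrite grid_sumS mulrDr {1}es1 es -!exprM !half -mulrDr -big_split /=.
rewrite -es es1 hornerZ horner_sum !mulr_sumr; apply: eq_bigr => B _.
rewrite -mulrDr es2 even_polyE hornerZ mulrA.
rewrite (_ : (k.+1 + k.+2 * m = (k + k.+1 * m + m).+1)%N) ?exprS ?exprD; last by lia.
have nz : 2 ^+ m != 0 :> C by rewrite expf_neq0 ?pnatr_eq0.
by field.
Qed.

End Product.
End GridAverage.

(** * Limits of the moments over the roots of unity *)

Section GridMoments.
Variable R : realType.
Local Notation C := R[i].
Implicit Types (s t : R) (k m r : nat).

(** The recursion has rational coefficients; this moves the complex identities to the reals, where
    the energy argument lives. *)
Lemma moment_coef_complex m k (B : {set 'I_m + 'I_m}) f :
  moment_coef C k B f = (moment_coef R k B f)%:C.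
Proof.
elim: k B f => [|k IH] B f.
  by rewrite !moment_coef0 rmorphM fmorphV rmorphXn rmorph_nat rmorph_nat.
rewrite !moment_coefS rmorphM fmorphV rmorphXn rmorph_nat rmorph_sum.
congr (_ * _); apply: eq_bigr => D _; rewrite rmorphM rmorph_prod; congr (_ * _).
  by apply: eq_bigr => j _; rewrite rmorphXn rmorphN1.
by rewrite !twisted_coefE; case: ifP => // _; rewrite ?rmorph0 // IH.
Qed.

Definition rs_weight k t : R := sqmod_circle (rsP C k) t / 2 ^+ k.+1.

Lemma rs_parallelogram k t :
  sqmod_circle (rsP C k) t + sqmod_circle (rsQ C k) t = 2 ^+ k.+1.
Proof.
apply: (fmorph_inj (real_complex R)); rewrite rmorphD rmorphXn rmorph_nat /=.
rewrite !sqmod_circleE -/(rs_val k false t) -/(rs_val k true t).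
elim: k => [|k IH].
  by rewrite /rs_val /rsP /rsQ /= !hornerC rmorph1 mulr1 expr1.
rewrite exprS -IH !rs_valS; set e := _ ^+ (2 ^ k).
have e1 : e^*%C * e = 1 by rewrite /e rmorphXn -exprMn expi_conjM expr1n.
rewrite expr0 expr1 !rmorphD !rmorphM rmorphN1 rmorph1 /=.
move: (rsQ C k).[expi t] (rsP C k).[expi t] e1 => p q e1; rewrite mulrC in e1.
transitivity (2 * (q * q^*%C + (e * e^*%C) * (p * p^*%C))); first by ring.
by rewrite e1 mul1r.
Qed.

Lemma rs_weightQ k t : 1 - rs_weight k t = sqmod_circle (rsQ C k) t / 2 ^+ k.+1.
Proof.
have nz : 2 ^+ k.+1 != 0 :> R by rewrite expf_neq0 ?pnatr_eq0.
by apply/eqP; rewrite subr_eq -mulrDl addrC rs_parallelogram divff.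
Qed.

Lemma sqmod_circle_ge0 (p : {poly C}) t : 0 <= sqmod_circle p t.
Proof.
have : 0 <= (sqmod_circle p t)%:C by rewrite sqmod_circleE -normCK exprn_ge0.
by rewrite lecR.
Qed.

Lemma rs_weight_ge0 k t : 0 <= rs_weight k t.
Proof. by rewrite divr_ge0 ?sqmod_circle_ge0 // exprn_ge0. Qed.

Lemma rs_weight_le1 k t : rs_weight k t <= 1.
Proof. by rewrite -subr_ge0 rs_weightQ divr_ge0 ?sqmod_circle_ge0 // exprn_ge0. Qed.

Definition grid_point k (j : nat) : R := 2 * pi *+ j / (2 ^ k)%:R.

Definition grid_mean k (g : R -> R) : R :=
  (\sum_(j < 2 ^ k) g (grid_point k j)) / (2 ^ k)%:R.

Lemma rs_prod_balanced m k (K L : {set 'I_m}) t : #|L| = #|K| ->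
  rs_prod k (set_sum K L) t = (2 ^+ (k.+1 * m) *
    (rs_weight k t ^+ (m - #|K|) * (1 - rs_weight k t) ^+ #|K|))%:C.
Proof.
move=> eLK; have card (M : {set 'I_m}) x y :
    \prod_i (if i \in M then x else y : C) = x ^+ #|M| * y ^+ (m - #|M|).
  have -> : (m - #|M|)%N = #|~: M| by rewrite [RHS]cardsCs setCK card_ord.
  rewrite (bigID (fun i => i \in M)) /=; congr (_ * _).
    by rewrite -prodr_const; apply: eq_bigr => i ->.
  by rewrite -prodr_const; apply: eq_big => i; rewrite ?inE // => /negPf->.
rewrite /rs_prod big_sumType /side_conj /=.
rewrite (eq_bigr (fun i => if i \in K then rs_val k true t else rs_val k false t));
  last by move=> i _; rewrite inE; case: ifP.
rewrite [X in _ * X](eq_bigr (fun i => if i \in L then (rs_val k true t)^*%C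
  else (rs_val k false t)^*%C)); last by move=> i _; rewrite inE; case: ifP.
rewrite !card eLK mulrACA -!exprMn /rs_val -!sqmod_circleE.
rewrite -!(rmorphXn (real_complex R)) -rmorphM /=.
rewrite rs_weightQ /rs_weight; congr (_%:C).
have leK : (#|K| <= m)%N by have := max_card (mem K); rewrite card_ord.
have -> : (2 : R) ^+ (k.+1 * m) = 2 ^+ k.+1 ^+ (m - #|K|) * 2 ^+ k.+1 ^+ #|K|.
  by rewrite -exprD subnK // exprM.
rewrite !expr_div_n.
by field; rewrite !expf_neq0 ?pnatr_eq0.
Qed.

(** At [s = 0] the polynomial is evaluated at 1, which sums its coefficients. *)
Lemma grid_mean_rs_weight m k (K L : {set 'I_m}) : #|L| = #|K| ->
  grid_mean k (fun t => rs_weight k t ^+ (m - #|K|) * (1 - rs_weight k t) ^+ #|K|) =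
  \sum_(f < m.*2.+1) moment_coef R k (set_sum K L) f.
Proof.
move=> eLK; have := grid_sum_rs_prod k (set_sum K L) (0 : R).
rewrite expi0 expr1n mul1r /grid_sum.
under eq_bigr => j _ do rewrite rs_prod_balanced // add0r -/(grid_point k j).
rewrite -rmorph_sum -mulr_sumr (@horner_coef_wide _ m.*2.+1) => [|]; last first.
  by apply/leq_sizeP => f ltf; exact: moment_coef_large.
under [in RHS]eq_bigr => f _.
  rewrite expr1n mulr1 -/(moment_coef C k (set_sum K L) f) moment_coef_complex.
  over.
rewrite -rmorph_sum exprD -(rmorph_nat (real_complex R) 2) -!(rmorphXn (real_complex R)) -!rmorphM.
move=> /(fmorph_inj (real_complex R)) /=.
have nz n : 2 ^+ n != 0 :> R by rewrite expf_neq0 ?pnatr_eq0.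
rewrite [2 ^+ k * _]mulrC -[RHS]mulrA => /(mulfI (nz _)).
rewrite /grid_mean natrX => ->; rewrite mulrAC mulfV ?mul1r //.
Qed.

Lemma grid_moment_cvg m r : (r <= m)%N ->
  null (fun k => 'C(m, r)%:R *
    grid_mean k (fun t => rs_weight k t ^+ (m - r) * (1 - rs_weight k t) ^+ r) -
    m.+1%:R^-1).
Proof.
move: r; apply: binomial_cvg => [K L eLK|k].
  have : null (fun k => - \sum_(f < m.*2.+1 | f != m :> nat) moment_coef R k (set_sum K L) f).
    by apply/nullN/null_sum => f; exact: null_off_center.
  apply: eq_null => k; rewrite (grid_mean_rs_weight k eLK).
  have ltm : (m < m.*2.+1)%N by lia.
  by rewrite [in RHS](bigD1 (Ordinal ltm)) //= opprD addrA subrr add0r.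
rewrite /grid_mean.
under eq_bigr => r _ do rewrite mulrA mulr_sumr.
rewrite -mulr_suml exchange_big /=.
rewrite (eq_bigr (fun=> 1)) => [|j _].
  by rewrite sumr_const card_ord mulfV // pnatr_eq0 expn_eq0.
set w := rs_weight _ _.
have := exprDn w (1 - w) m; rewrite addrC subrK expr1n => e; rewrite [RHS]e.
by apply: eq_bigr => r _; rewrite mulr_natl.
Qed.

End GridMoments.

(** * From Bernstein moments to the number of small values *)

Section Bernstein.
Variable R : realType.
Implicit Types (u v c : R) (m r p k : nat).

Lemma bernstein_sumS m u v (f : nat -> R) :
  \sum_(r < m.+2) 'C(m.+1, r)%:R * (u ^+ (m.+1 - r) * v ^+ r) * f r =
  u * \sum_(r < m.+1) 'C(m, r)%:R * (u ^+ (m - r) * v ^+ r) * f r +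
  v * \sum_(r < m.+1) 'C(m, r)%:R * (u ^+ (m - r) * v ^+ r) * f r.+1.
Proof.
rewrite big_ord_recl [X in u * X]big_ord_recl /= !bin0 !subn0 mulrDr -addrA.
congr (_ + _); first by rewrite exprS; ring.
rewrite (eq_bigr (fun r : 'I_m.+1 =>
    'C(m, r.+1)%:R * (u ^+ (m - r) * v ^+ r.+1) * f r.+1 +
    v * ('C(m, r)%:R * (u ^+ (m - r) * v ^+ r) * f r.+1))) => [|r _]; last first.
  by rewrite /bump leq0n add1n binS natrD subSS exprS; ring.
rewrite big_split /= -mulr_sumr; congr (_ + _).
rewrite big_ord_recr /= bin_small // !mul0r addr0 mulr_sumr.
apply: eq_bigr => r _; rewrite /bump leq0n add1n.
have -> : u ^+ (m - r) = u * u ^+ (m - r.+1).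
  by rewrite -exprS; congr (_ ^+ _); have := ltn_ord r; lia.
by ring.
Qed.

(** The second moment of a binomial variable about [c]: variance plus squared bias. A free [c] lets
    the induction replace [c] by [c - 1]. *)
Lemma bernstein_variance m u v c : u + v = 1 ->
  \sum_(r < m.+1) 'C(m, r)%:R * (u ^+ (m - r) * v ^+ r) * (r%:R - c) ^+ 2 =
  m%:R * u * v + (m%:R * v - c) ^+ 2.
Proof.
move=> uv; have -> : u = 1 - v by rewrite -uv addrK.
elim: m c => [|m IH] c; first by rewrite big_ord1 /= bin0 !expr0; ring.
rewrite (bernstein_sumS m (1 - v) v (fun r => (r%:R - c) ^+ 2)) IH.
rewrite (eq_bigr (fun r : 'I_m.+1 => 'C(m, r)%:R * ((1 - v) ^+ (m - r) * v ^+ r) *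
   (r%:R - (c - 1)) ^+ 2)) ?IH => [|r _]; last by rewrite -[r.+1]addn1 natrD; congr (_ * _); ring.
by rewrite -[m.+1]addn1 natrD; ring.
Qed.

(** Chebyshev's inequality: [m - r] is binomial with mean [m u], and for [u >= theta] the event
    [m - r < p] is a deviation of more than [d m]. *)
Lemma bernstein_tail m p u (theta d : R) : (0 < m)%N -> 0 <= u <= 1 -> 0 < d ->
  p%:R <= (theta - d) * m%:R ->
  \sum_(r < m.+1 | (rev_ord r < p)%N) 'C(m, r)%:R * (u ^+ (m - r) * (1 - u) ^+ r)
  <= (u < theta)%R%:R + (d ^+ 2 * m%:R)^-1.
Proof.
move=> m0 /andP[u0 u1] d0 lep; have v0 : 0 <= 1 - u by rewrite subr_ge0.
have m0' : 0 < m%:R :> R by rewrite ltr0n.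
have uv : u + (1 - u) = 1 by rewrite addrC subrK.
pose b (r : 'I_m.+1) := 'C(m, r)%:R * (u ^+ (m - r) * (1 - u) ^+ r).
have b0 (r : 'I_m.+1) : 0 <= b r by rewrite !mulr_ge0 ?exprn_ge0.
have [ltu|leu] := ltP u theta.
  apply: (@le_trans _ _ 1); last by rewrite lerDl invr_ge0 mulr_ge0 ?sqr_ge0 ?ltW.
  have sumb : \sum_r b r = 1.
    rewrite -[RHS](expr1n _ m) -[in RHS]uv exprDn.
    by apply: eq_bigr => r _; rewrite -mulr_natl.
  rewrite -[leRHS]sumb [leRHS](bigID (fun r : 'I_m.+1 => (rev_ord r < p)%N)) /= lerDl.
  exact: sumr_ge0.
rewrite add0r -[leRHS]mul1r ler_pdivlMr ?mulr_gt0 ?exprn_gt0 //.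
rewrite -(ler_pM2l m0') mulr1 mulrC -mulrA mulr_suml.
have var := bernstein_variance m (m%:R * (1 - u)) uv.
apply: (@le_trans _ _ (m%:R * u * (1 - u))); last first.
  by rewrite -mulrA ler_piMr ?ltW //; nra.
rewrite subrr expr0n addr0 in var; rewrite -var.
rewrite [leRHS](bigID (fun r : 'I_m.+1 => (rev_ord r < p)%N)) /= ler_wpDr //.
  by apply: sumr_ge0 => r _; rewrite mulr_ge0 ?sqr_ge0 ?b0.
apply: ler_sum => r ltr; rewrite ler_wpM2l ?b0 //.
rewrite (_ : d ^+ 2 * m%:R * m%:R = (d * m%:R) ^+ 2); last by ring.
have le_dm : d * m%:R <= r%:R - m%:R * (1 - u).
  have : m%:R <= r%:R + p%:R :> R.
    by rewrite -natrD ler_nat; move: ltr; rewrite /=; lia.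
  have := ler_wpM2l (ltW m0') leu; nra.
have dm0 : 0 <= d * m%:R by rewrite mulr_ge0 ?ltW.
by rewrite ler_pXn2r ?nnegrE // (le_trans dm0).
Qed.

Variable w : nat -> R -> R.
Hypothesis w01 : forall k t, 0 <= w k t <= 1.
Hypothesis cvg_moments : forall m r, (r <= m)%N ->
  null (fun k => 'C(m, r)%:R *
    grid_mean k (fun t => w k t ^+ (m - r) * (1 - w k t) ^+ r) - m.+1%:R^-1).

Local Notation num_below k theta :=
  #|[set j : 'I_(2 ^ k) | w k (grid_point R k j) < theta]|.

Lemma num_below_ge (theta delta : R) : theta <= 1 -> 0 < delta ->
  exists k0, forall k, (k0 <= k)%N ->
    (theta - delta) * (2 ^ k)%:R <= (num_below k theta)%:R.
Proof.
move=> theta1 delta0; have n0 k : 0 < (2 ^ k)%:R :> R by rewrite ltr0n expn_gt0.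
have [lt4|le4] := ltP theta (delta / 4).
  exists 0%N => k _; apply: (@le_trans _ _ 0) => //.
  by rewrite mulr_le0_ge0 ?ltW //; lra.
(* [d] is lost four times: in [p], in rounding [p], in the Chebyshev term and in the approach to the
   limit [p / (m + 1)]. *)
have [d d0 dE] : exists2 d : R, 0 < d & delta = 4 * d.
  by exists (delta / 4); [rewrite divr_gt0 ?ltr0n | field].
have d3 : 0 < (d ^+ 3)^-1 by rewrite invr_gt0 exprn_gt0.
have dV : 0 < 2 / d by rewrite divr_gt0.
(* The term [2 / d] absorbs the rounding of [p]; [d^-3] makes the Chebyshev term at most [d]. *)
pose M := Num.bound (2 / d + (d ^+ 3)^-1); pose m := M.+1.
have ltM : 2 / d + (d ^+ 3)^-1 < m%:R.
  apply: lt_trans (_ : M%:R < _); last by rewrite ltr_nat.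
  by apply: archi_boundP; rewrite ltW // addr_gt0.
have m0 : 0 < m%:R :> R by rewrite ltr0n.
have small1 : 2 <= d * m.+1%:R.
  rewrite mulrC -ler_pdivrMr // (@le_trans _ _ m%:R) ?ler_nat //.
  by apply: ltW; apply: lt_trans ltM; rewrite ltrDl.
have small2 : (d ^+ 2 * m%:R)^-1 <= d.
  rewrite -[leLHS]mul1r ler_pdivrMr ?mulr_gt0 ?exprn_gt0 //.
  rewrite mulrA -exprS mulrC -ler_pdivrMr ?exprn_gt0 // mul1r ltW //.
  by apply: lt_trans ltM; rewrite ltrDr.
pose p := Num.trunc ((theta - d) * m%:R).
have td0 : 0 <= theta - d by move: le4; rewrite dE; lra.
have /truncn_itv/andP[] : 0 <= (theta - d) * m%:R by rewrite mulr_ge0 // ltW.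
rewrite -/p => lep ltp.
have lepm : (p <= m.+1)%N.
  rewrite -(ler_nat R); apply: le_trans lep _; rewrite -[m.+1]addn1 natrD; nra.
pose f k t : R := \sum_(r < m.+1 | (rev_ord r < p)%N) 'C(m, r)%:R *
  (w k t ^+ (m - r) * (1 - w k t) ^+ r).
have cvgf : null (fun k => grid_mean k (f k) - p%:R / m.+1%:R).
  have : null (fun k => \sum_(r < m.+1 | (rev_ord r < p)%N) ('C(m, r)%:R *
    grid_mean k (fun t : R => w k t ^+ (m - r) * (1 - w k t) ^+ r) -
    m.+1%:R^-1)).
    by apply: null_sum => r _; apply: cvg_moments; rewrite -ltnS.
  apply: eq_null => k; rewrite sumrB; congr (_ - _).
    rewrite /grid_mean exchange_big /= mulr_suml.
    by apply: eq_bigr => r _; rewrite mulrA mulr_sumr.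
  rewrite sumr_const -[RHS]mulrC mulr_natr; congr (_ *+ _).
  rewrite -sum1_card (reindex_inj rev_ord_inj) (eq_bigl (fun r : 'I_m.+1 => (r < p)%N)); last first.
    by move=> r; rewrite -[r in RHS]rev_ordK.
  by rewrite -(big_ord_widen _ (fun=> 1%N)) // sum1_card card_ord.
have /cvgr0_norm_lt/(_ d d0)[k0 _ near0] := cvgf.
exists k0 => k /near0 /=; rewrite ltr_norml => /andP[lo _].
have mean_le : grid_mean k (f k) <=
    (num_below k theta)%:R / (2 ^ k)%:R + (d ^+ 2 * m%:R)^-1.
  rewrite /grid_mean ler_pdivrMr // mulrDl mulfVK ?gt_eqF //.
  have -> : (num_below k theta)%:R + (d ^+ 2 * m%:R)^-1 * (2 ^ k)%:R =
    \sum_(j < 2 ^ k) ((w k (grid_point R k j) < theta)%R%:R + (d ^+ 2 * m%:R)^-1).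
    rewrite big_split /= sumr_const card_ord mulr_natr; congr (_ + _).
    by rewrite -sum1_card natr_sum big_mkcond /=; apply: eq_bigr => j _; rewrite inE; case: ltP.
  apply: ler_sum => j _; apply: bernstein_tail => //.
rewrite -ler_pdivlMr //.
suff : theta - d - d <= p%:R / m.+1%:R.
  move: lo mean_le small2; 
  move: (grid_mean k (f k)) (p%:R / m.+1%:R) (_ / (2 ^ k)%:R) (_ * _)^-1 => x y z c.
  by rewrite dE; lra.
rewrite ler_pdivlMr ?ltr0n //; move: small1 ltp.
rewrite -[m.+1]addn1 -[p.+1]addn1 !natrD; nra.
Qed.

End Bernstein.

(** * An interpolation formula for symmetric differences *)

Section Interpolation.
Variables (R : realType) (D : nat) (x : R).
Hypotheses (D0 : (0 < D)%N) (x0 : 0 < x) (xD : x * D%:R *+ 2 < pi).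
Implicit Types (t : R) (m r : nat) (F : R -> R).

(** The extrema of [sin (D t)] in [[0, pi]]; the bound on [x] puts it before the first one, so that
    all weights are positive. *)
Definition node r : R := r.*2.+1%:R * (pi / D.*2%:R).

Definition node_weight r : R := (cos x - cos (node r))^-1.

Definition node_sum m : R := \sum_(r < D) (-1) ^+ r * node_weight r * sin (m%:R * node r).

Let D2 : 0 < D.*2%:R :> R. Proof. by rewrite ltr0n double_gt0. Qed.
Let D1 : 0 < D%:R :> R. Proof. by rewrite ltr0n. Qed.
Let piD : 0 < pi / D.*2%:R :> R. Proof. by rewrite divr_gt0 ?pi_gt0. Qed.
Let xpi : x < pi / D.*2%:R.
Proof. by rewrite ltr_pdivlMr // -mul2n mulnC natrM mulrA mulr_natr. Qed.
Let piE : pi = D.*2%:R * (pi / D.*2%:R) :> R.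
Proof. by rewrite mulrCA mulfV ?mulr1 // gt_eqF. Qed.
Let piE2 : pi / 2 = D%:R * (pi / D.*2%:R) :> R.
Proof. by rewrite -mul2n natrM; field; rewrite gt_eqF. Qed.

Lemma node_weight_gt0 r : (r < D)%N -> 0 < node_weight r.
Proof.
move=> ltr; rewrite invr_gt0 subr_gt0 /node.
have le1 : (1 : R) <= r.*2.+1%:R by rewrite ler1n.
have lex : x < node r by rewrite (lt_le_trans xpi) // ler_peMl // ltW.
have lepi : node r <= pi by rewrite [leRHS]piE ler_pM2r // ler_nat; lia.
rewrite ltr_cos // in_itv /= ?lepi ?(ltW x0) ?(le_trans (ltW x0) (ltW lex)) //.
by rewrite (le_trans (ltW lex)).
Qed.

(** Multiplied by [2 cos a], the sum telescopes to a multiple of [sin (m pi) = 0]; [m < D] keeps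
    [cos a] positive. *)
Lemma sum_sin_node m : (m < D)%N -> \sum_(r < D) (-1) ^+ r * sin (m%:R * node r) = 0.
Proof.
move=> ltm; pose a : R := m%:R * (pi / D.*2%:R).
have tele N : 2 * cos a * (\sum_(r < N) (-1) ^+ r * sin (m%:R * node r)) =
    - (-1) ^+ N * sin (N.*2%:R * a).
  elim: N => [|N IH]; first by rewrite big_ord0 mulr0 mul0r sin0 mulr0.
  rewrite big_ord_recr /= mulrDr IH exprS.
  have -> : m%:R * node N = N.*2%:R * a + a by rewrite /node /a -addn1 natrD; ring.
  have -> : N.+1.*2%:R * a = N.*2%:R * a + a + a.
    by rewrite doubleS -addn2 natrD; ring.
  have : sin (N.*2%:R * a) = sin (N.*2%:R * a + a) * cos a - cos (N.*2%:R * a + a) * sin a.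
    by rewrite -sinB addrK.
  by move=> ->; rewrite [sin (_ + a + a)]sinD; ring.
have a0 : 0 <= a by apply: mulr_ge0 => //; exact: ltW.
have cosa : 0 < cos a.
  apply: cos_gt0_pihalf; rewrite piE2 /a ltr_pM2r // ltr_nat ltm andbT.
  by rewrite (lt_le_trans _ a0) // oppr_lt0 mulr_gt0.
have := tele D; rewrite (_ : _ * a = pi *+ m); last first.
  by rewrite /a mulrCA -piE mulr_natl.
rewrite -[pi *+ m]add0r (alternatingn (@sinDpi R)) sin0 !mulr0 => /eqP.
have nz : 2 * cos a != 0 by rewrite gt_eqF // mulr_gt0.
by rewrite mulf_eq0 (negPf nz) => /eqP.
Qed.

(** The recurrence of [sin (m x)]: in the difference of the two sides [cos x - cos (node r)] cancels
    the weight and leaves the vanishing alternating sum. *)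
Lemma node_sum_rec m : (m.+1 < D)%N ->
  node_sum m.+2 + node_sum m = 2 * cos x * node_sum m.+1.
Proof.
move=> ltm; have := sum_sin_node ltm.
move/(congr1 (fun z => 2 * z)); rewrite mulr0 => z0.
apply/eqP; rewrite eq_sym -subr_eq0 -z0 /node_sum !mulr_sumr -big_split -sumrB /=.
apply/eqP/eq_bigr => r _.
have nz : cos x - cos (node r) != 0.
  by have := node_weight_gt0 (ltn_ord r); rewrite invr_gt0 => /gt_eqF ->.
have -> : m.+2%:R * node r = m.+1%:R * node r + node r.
  by rewrite -[m.+2]addn1 natrD; ring.
have -> : m%:R * node r = m.+1%:R * node r - node r.
  by rewrite -[m.+1]addn1 natrD; ring.
rewrite sinD sinB.
transitivity (2 * ((-1) ^+ r * sin (m.+1%:R * node r)) *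
  (node_weight r * (cos x - cos (node r)))); first by ring.
by rewrite /node_weight mulVf ?mulr1.
Qed.

Lemma node_sum0 : node_sum 0 = 0.
Proof. by rewrite /node_sum big1 // => r _; rewrite mul0r sin0 mulr0. Qed.

Lemma node_sum_sin m : (m <= D)%N -> node_sum m * sin x = node_sum 1 * sin (m%:R * x).
Proof.
suff : ((m <= D)%N -> node_sum m * sin x = node_sum 1 * sin (m%:R * x)) /\
  ((m.+1 <= D)%N -> node_sum m.+1 * sin x = node_sum 1 * sin (m.+1%:R * x)) by case.
elim: m => [|m [IH1 IH2]].
  by rewrite node_sum0 !mul0r sin0 mulr0 mul1r.
split=> // ltm; have {}IH2 := IH2 (ltnW ltm); have {}IH1 := IH1 (ltnW (ltnW ltm)).
have -> : node_sum m.+2 = 2 * cos x * node_sum m.+1 - node_sum m.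
  by rewrite -node_sum_rec // addrK.
transitivity (2 * cos x * (node_sum m.+1 * sin x) - node_sum m * sin x); first by ring.
rewrite IH1 IH2.
have -> : m.+2%:R * x = m.+1%:R * x + x by rewrite -[m.+2]addn1 natrD; ring.
have -> : m%:R * x = m.+1%:R * x - x by rewrite -[m.+1]addn1 natrD; ring.
by rewrite sinB sinD; ring.
Qed.

Lemma node_sum_top : node_sum D = \sum_(r < D) node_weight r.
Proof.
apply: eq_bigr => r _; have -> : D%:R * node r = pi / 2 + pi *+ r.
  rewrite -[pi *+ r]mulr_natl /node -addn1 natrD -!mul2n !natrM.
  by field; rewrite gt_eqF.
rewrite (alternatingn (@sinDpi R)) sin_pihalf.
by rewrite mulr1 mulrAC -expr2 sqrr_sign mul1r.
Qed.

Lemma node_sum_top_gt0 : 0 < node_sum D.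
Proof.
rewrite node_sum_top (bigD1 (Ordinal D0)) //= ltr_wpDr ?node_weight_gt0 //.
by apply: sumr_ge0 => r _; rewrite ltW ?node_weight_gt0.
Qed.

Lemma sin_x_gt0 : 0 < sin x.
Proof.
apply: sin_gt0_pi; rewrite x0 (lt_le_trans xpi) // [leRHS]piE ler_peMl ?(ltW piD) //.
by rewrite ler1n double_gt0.
Qed.

Lemma sin_interpolation m : (m <= D)%N ->
  sin (m%:R * x) * node_sum D = sin (D%:R * x) * node_sum m.
Proof.
move=> lem; have nz : sin x != 0 by rewrite gt_eqF // sin_x_gt0.
apply: (mulIf nz).
by rewrite -mulrA (node_sum_sin (leqnn D)) -[RHS]mulrA (node_sum_sin lem); ring.
Qed.

(** Division by [x] and the limit [x -> 0] turn this into M. Riesz's formula for the derivative of a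
    trigonometric polynomial. *)
Definition interpolated F : Prop := forall t,
  (F (t + x) - F (t - x)) * node_sum D =
  sin (D%:R * x) * \sum_(r < D) (-1) ^+ r * node_weight r * (F (t + node r) - F (t - node r)).

Lemma interpolatedD F G : interpolated F -> interpolated G ->
  interpolated (fun t => F t + G t).
Proof.
move=> hF hG t; transitivity ((F (t + x) - F (t - x)) * node_sum D +
  (G (t + x) - G (t - x)) * node_sum D); first by ring.
by rewrite hF hG -mulrDr -big_split; congr (_ * _); apply: eq_bigr => r _; rewrite /=; ring.
Qed.

Lemma interpolatedM c F : interpolated F -> interpolated (fun t => c * F t).
Proof.
move=> hF t; transitivity (c * ((F (t + x) - F (t - x)) * node_sum D)); first by ring.
rewrite hF mulrCA mulr_sumr; congr (_ * _).
by apply: eq_bigr => r _; ring.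
Qed.

Lemma interpolated_sum (I : finType) (F : I -> R -> R) :
  (forall i, interpolated (F i)) -> interpolated (fun t => \sum_i F i t).
Proof.
move=> hF; elim: (index_enum I) => [|i s IH].
  move=> t; rewrite !big_nil subrr mul0r big1 ?mulr0 // => r _.
  by rewrite !big_nil subrr mulr0.
suff -> : (fun t => \sum_(j <- i :: s) F j t) = fun t => F i t + \sum_(j <- s) F j t.
  exact: interpolatedD.
by apply/funext => t; rewrite big_cons.
Qed.

Lemma sin_interpolation_diff a b : (a <= D)%N -> (b <= D)%N ->
  sin ((a%:R - b%:R) * x) * node_sum D = sin (D%:R * x) *
  \sum_(r < D) (-1) ^+ r * node_weight r * sin ((a%:R - b%:R) * node r).
Proof.
wlog leba : a b / (b <= a)%N => [hw|] lea leb.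
  have [/hw|/ltnW /hw hba] := leqP b a; first exact.
  have opp y : (a%:R - b%:R) * y = - ((b%:R - a%:R) * y) :> R by ring.
  rewrite opp sinN mulNr hba // -mulrN -sumrN; congr (_ * _).
  by apply: eq_bigr => r _; rewrite opp sinN mulrN.
by rewrite -natrB //; apply: sin_interpolation; lia.
Qed.

Lemma interpolated_cos a b : (a <= D)%N -> (b <= D)%N ->
  interpolated (fun t => cos ((a%:R - b%:R) * t)).
Proof.
move=> lea leb t; set c := a%:R - b%:R.
have diff y : cos (c * (t + y)) - cos (c * (t - y)) = - 2 * sin (c * t) * sin (c * y).
  by rewrite mulrDr mulrBr cosD cosB; ring.
rewrite /= diff -[LHS]mulrA (sin_interpolation_diff lea leb) mulrCA mulr_sumr; congr (_ * _).
by apply: eq_bigr => r _; rewrite /= diff; ring.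
Qed.

Lemma interpolated_sin a b : (a <= D)%N -> (b <= D)%N ->
  interpolated (fun t => sin ((a%:R - b%:R) * t)).
Proof.
move=> lea leb t; set c := a%:R - b%:R.
have diff y : sin (c * (t + y)) - sin (c * (t - y)) = 2 * cos (c * t) * sin (c * y).
  by rewrite mulrDr mulrBr sinD sinB; ring.
rewrite /= diff -[LHS]mulrA (sin_interpolation_diff lea leb) mulrCA mulr_sumr; congr (_ * _).
by apply: eq_bigr => r _; rewrite /= diff; ring.
Qed.

(** The positive weights add up to [node_sum D], and each difference at the nodes is at most [2M],
    as [c] cancels. *)
Lemma interpolated_dist F c M : interpolated F -> (forall t, `|F t - c| <= M) ->
  forall t, `|F (t + x) - F (t - x)| <= sin (D%:R * x) * (M *+ 2).
Proof.
move=> hF leM t; have w0 := node_sum_top_gt0.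
have s0 : 0 <= sin (D%:R * x).
  apply: sin_ge0_pi; rewrite mulr_ge0 ?(ltW x0) //= mulrC.
  rewrite (le_trans _ (ltW xD)) // mulr2n lerDl mulr_ge0 ?(ltW x0) //.
rewrite -(ler_pM2r w0) -{1}(gtr0_norm w0) -normrM hF normrM ger0_norm // -mulrA.
rewrite ler_wpM2l // node_sum_top mulr_sumr (le_trans (ler_norm_sum _ _ _)) //.
apply: ler_sum => r _; rewrite normrM normrM normr_sign mul1r.
rewrite gtr0_norm ?node_weight_gt0 // mulrC ler_wpM2r ?(ltW (node_weight_gt0 (ltn_ord r))) //.
rewrite (_ : F (t + node r) - F (t - node r) = (F (t + node r) - c) - (F (t - node r) - c)); last by ring.
by rewrite mulr2n (le_trans (ler_normB _ _)) // lerD.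
Qed.

End Interpolation.

(** * The squared modulus on the circle as a trigonometric polynomial *)

Section CircleModulus.
Variable R : realType.
Local Notation C := R[i].
Implicit Types (t : R) (p : {poly C}) (k : nat).

Lemma sqmod_circle_trig p n t : (size p <= n)%N -> sqmod_circle p t =
  \sum_(a < n) \sum_(b < n)
    (complex.Re (p`_a * (p`_b)^*%C) * cos ((a%:R - b%:R) * t) +
     - complex.Im (p`_a * (p`_b)^*%C) * sin ((a%:R - b%:R) * t)).
Proof.
move=> len; have Re_sum (I : finType) (f : I -> C) :
    complex.Re (\sum_i f i) = \sum_i complex.Re (f i).
  by elim/big_rec2: _ => // i x y _ <-; case: y; case: (f i).
rewrite -[LHS]/(complex.Re (sqmod_circle p t)%:C) sqmod_circleE.
rewrite (horner_coef_wide _ len) rmorph_sum big_distrlr Re_sum.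
apply: eq_bigr => a _; rewrite Re_sum; apply: eq_bigr => b _.
rewrite rmorphM rmorphXn /= -[_ -i* _]/((expi t)^*%C) expi_conj -!expiMn mulrACA -expiD.
rewrite (_ : t *+ a + - t *+ b = (a%:R - b%:R) * t); last first.
  by rewrite mulrBl !mulr_natl mulNrn.
by case: (p`_a * _) => u v; rewrite /expi; simpc.
Qed.

Lemma sqmod_circle_continuous p : continuous (sqmod_circle p).
Proof.
have csum (I : finType) (f : I -> R -> R) :
    (forall i, continuous (f i)) -> continuous (fun t => \sum_i f i t).
  move=> cf; elim: (index_enum I) => [|i s IH].
    rewrite (_ : (fun t => _) = fun=> 0); first exact: cst_continuous.
    by apply/funext => t; rewrite big_nil.
  rewrite (_ : (fun t => _) = fun t => f i t + \sum_(j <- s) f j t).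
    by move=> t; apply: continuousD; [exact: cf | exact: IH].
  by apply/funext => t; rewrite big_cons.
have -> : sqmod_circle p = fun t => \sum_(a < size p) \sum_(b < size p)
    (complex.Re (p`_a * (p`_b)^*%C) * cos ((a%:R - b%:R) * t) +
     - complex.Im (p`_a * (p`_b)^*%C) * sin ((a%:R - b%:R) * t)).
  by apply/funext => t; apply: sqmod_circle_trig.
apply: (csum) => a; apply: (csum) => b t /=; set c := a%:R - b%:R.
have cc : {for t, continuous (fun t => c * t)} by apply: mulrl_continuous.
apply: cvgD; apply: cvgMl_tmp.
  by apply: (continuous_comp cc); exact: continuous_cos.
by apply: (continuous_comp cc); exact: continuous_sin.
Qed.

Lemma sqmod_circle_dist p D x M : (0 < D)%N -> (size p <= D)%N ->
  0 < x -> x * D%:R *+ 2 < pi -> (forall t, sqmod_circle p t <= M *+ 2) ->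
  forall t, `|sqmod_circle p (t + x) - sqmod_circle p (t - x)| <=
            sin (D%:R * x) * (M *+ 2).
Proof.
move=> D0 lep x0 xD leM; apply: (@interpolated_dist R D x D0 x0 xD _ M); last first.
  move=> t; have := leM t; have := sqmod_circle_ge0 p t.
  by rewrite ler_norml mulr2n; move=> *; apply/andP; split; lra.
rewrite (_ : sqmod_circle p = fun t => \sum_(a < D) \sum_(b < D)
    (complex.Re (p`_a * (p`_b)^*%C) * cos ((a%:R - b%:R) * t) +
     - complex.Im (p`_a * (p`_b)^*%C) * sin ((a%:R - b%:R) * t))); last first.
  by apply/funext => t; apply: sqmod_circle_trig.
apply: interpolated_sum => a; apply: interpolated_sum => b.
have [lea leb] : (a <= D)%N /\ (b <= D)%N by split; exact: ltnW.
by apply: interpolatedD; apply: interpolatedM;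
  [exact: interpolated_cos | exact: interpolated_sin].
Qed.

Definition rs_poly k (b : bool) : {poly C} := if b then rsQ C k else rsP C k.

Lemma rs_polyE k b t : (rs_poly k b).[expi t] = rs_val k b t.
Proof. by case: b. Qed.

Lemma size_rs_poly k b : (size (rs_poly k b) <= 2 ^ k)%N.
Proof.
elim: k b => [|k IH] b; first by case: b; rewrite /rs_poly /= size_poly1.
have := IH true; have := IH false; rewrite /rs_poly => sP sQ.
have le1 : (2 ^ k <= 2 ^ k.+1)%N by rewrite leq_exp2l.
have sXQ : (size ('X^(2 ^ k) * rsQ C k)%R <= 2 ^ k.+1)%N.
  rewrite (leq_trans (size_polyMleq _ _)) // size_polyXn /=.
  by rewrite expnS mul2n -addnn leq_add2l.
by case: b; rewrite ?rsPS ?rsQS (leq_trans (size_polyD _ _)) // geq_max ?size_polyN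
   sXQ andbT (leq_trans sP).
Qed.

Lemma sqmod_rs_polyN k b t :
  sqmod_circle (rs_poly k (~~ b)) t = 2 ^+ k.+1 - sqmod_circle (rs_poly k b) t.
Proof. by rewrite -(rs_parallelogram k t); case: b; rewrite /rs_poly /=; ring. Qed.

Lemma sqmod_rs_poly_le k b t : sqmod_circle (rs_poly k b) t <= 2 ^+ k.+1.
Proof. by have := sqmod_circle_ge0 (rs_poly k (~~ b)) t; rewrite sqmod_rs_polyN subr_ge0. Qed.

(* At the [2 ^ k.+2]-th roots of unity [z ^ (2 ^ k.+1) = 1] or [-1], so that
   two steps of the recursion collapse to [2 P_k] or [2 z ^ (2 ^ k) Q_k]. *)
Lemma sqmod_rs_poly_grid k b j :
  sqmod_circle (rs_poly k.+2 b) (grid_point R k.+2 j) =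
  4 * sqmod_circle (rs_poly k (b (+) odd j)) (grid_point R k.+2 j).
Proof.
apply: (fmorph_inj (real_complex R)); rewrite rmorphM rmorph_nat /=.
rewrite !sqmod_circleE !rs_polyE; set t := grid_point _ _ _.
have ez : expi t ^+ (2 ^ k.+1) = (-1) ^+ j.
  rewrite -expiMn /t /grid_point -[_ *+ (2 ^ _)]mulr_natr -expi_pi -expiMn.
  congr expi; rewrite -[RHS]mulr_natr -[2 * pi *+ j]mulr_natr [(2 ^ k.+2)%N]expnS natrM.
  by field; rewrite pnatr_eq0 expn_eq0.
set e := expi t ^+ (2 ^ k).
have e1 : e * e^*%C = 1 by rewrite /e rmorphXn -exprMn mulrC expi_conjM expr1n.
have step (c d : bool) (q p : C) :
    let z := (-1) ^+ c * ((-1) ^+ d * (- (e * q) + p)) + (e * q + p) in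
    let y := if c (+) d then q else p in z * z^*%C = 4 * (y * y^*%C).
  case: c; case: d => /=; rewrite ?expr0 ?expr1 ?mul1r ?mulN1r;
    rewrite !(rmorphD, rmorphN, rmorphM) /=.
  - by ring.
  - by transitivity (4 * ((e * e^*%C) * (q * q^*%C))); [ring | rewrite e1 mul1r].
  - by transitivity (4 * ((e * e^*%C) * (q * q^*%C))); [ring | rewrite e1 mul1r].
  - by ring.
have := step b (odd j) (rs_val k true t) (rs_val k false t).
rewrite [rs_val k.+2 b t]rs_valS ez -[(-1) ^+ j]signr_odd !rs_valS -/e expr0 expr1 mul1r mulN1r.
by move=> ->; case: (b (+) odd j).
Qed.

End CircleModulus.

(** * Crossings and the count of solutions *)

Section Solutions.
Variable R : realType.
Local Notation C := R[i].
Implicit Types (t : R) (b : bool) (k m r : nat).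

Definition rs_poly_weight b k t : R := sqmod_circle (rs_poly R k b) t / 2 ^+ k.+1.

Lemma rs_poly_weightE b k t :
  rs_poly_weight b k t = if b then 1 - rs_weight k t else rs_weight k t.
Proof. by case: b; rewrite ?rs_weightQ. Qed.

Lemma rs_poly_weight01 b k t : 0 <= rs_poly_weight b k t <= 1.
Proof.
have := rs_weight_ge0 k t; have := rs_weight_le1 k t; rewrite rs_poly_weightE.
by case: b => *; apply/andP; split; lra.
Qed.

Lemma rs_poly_moment_cvg b m r : (r <= m)%N ->
  null (fun k => 'C(m, r)%:R * grid_mean k (fun t : R =>
    rs_poly_weight b k t ^+ (m - r) * (1 - rs_poly_weight b k t) ^+ r) - m.+1%:R^-1).
Proof.
move=> lerm; case: b; last first.
  have := @grid_moment_cvg R m r lerm; apply: eq_null => k; congr (_ * grid_mean _ _ - _).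
have := @grid_moment_cvg R m _ (leq_subr r m); apply: eq_null => k.
rewrite bin_sub //; congr (_ * grid_mean _ _ - _).
by apply/funext => t; rewrite rs_poly_weightE subKr subKn // mulrC.
Qed.

Local Notation t_ k j := (grid_point R k j).

Lemma cos_pi4 : cos (pi / 4) = 1 - 2 * sin (pi / 8) ^+ 2 :> R.
Proof.
rewrite (_ : pi / 4 = pi / 8 + pi / 8); last by field.
by rewrite cosD -!expr2 cos2sin2; ring.
Qed.

Lemma sin_pi4 : sin (pi / 4) = cos (pi / 4) :> R.
Proof. by rewrite -cosN -sinDpihalf; congr sin; field. Qed.

Lemma grid_pointS k j : t_ k j.+1 = t_ k j + 2 * pi / (2 ^ k)%:R.
Proof. by rewrite /grid_point mulrSr mulrDl. Qed.

(* Consecutive grid points see [4 |P_k| ^ 2] and [4 |Q_k| ^ 2], which add up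
   to [2 * 2 ^ k.+2]; since [|P_k| ^ 2] cannot vary fast, they are not both small. *)
Lemma rs_poly_grid_not_both_low b k j (eta : R) : eta < 2 * sin (pi / 8) ^+ 2 ->
  sqmod_circle (rs_poly R k.+2 b) (t_ k.+2 j) < eta * (2 ^ k.+2)%:R ->
  eta * (2 ^ k.+2)%:R <= sqmod_circle (rs_poly R k.+2 b) (t_ k.+2 j.+1).
Proof.
move=> lteta low; rewrite leNgt; apply/negP; move: low.
rewrite !sqmod_rs_poly_grid /= addbN sqmod_rs_polyN.
set c := b (+) odd j; set F := sqmod_circle (rs_poly R k c).
have N0 : 0 < (2 ^ k)%:R :> R by rewrite ltr0n expn_gt0.
pose x : R := pi / (2 ^ k.+2)%:R.
have x0 : 0 < x by rewrite divr_gt0 ?pi_gt0 // ltr0n expn_gt0.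
have N4 : (2 ^ k.+2)%:R = 4 * (2 ^ k)%:R :> R by rewrite !expnS !natrM; ring.
have Dx : (2 ^ k)%:R * x = pi / 4 by rewrite /x N4; field; rewrite gt_eqF.
have e1 : (2 : R) ^+ k.+1 = (2 ^ k)%:R *+ 2 by rewrite natrX exprS mulr_natl.
have xD : x * (2 ^ k)%:R *+ 2 < pi.
  by rewrite mulrC Dx -mulr_natl; have := @pi_gt0 R; lra.
have leF t : F t <= (2 ^ k)%:R *+ 2 by rewrite -e1; exact: sqmod_rs_poly_le.
have := sqmod_circle_dist (expn_gt0 2 k) (size_rs_poly R k c) x0 xD leF (t_ k.+2 j + x).
rewrite Dx sin_pi4 cos_pi4 addrK -/F.
have -> : t_ k.+2 j + x + x = t_ k.+2 j.+1.
  by rewrite grid_pointS -addrA; congr (_ + _); rewrite /x; field; rewrite pnatr_eq0 expn_eq0.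
(* With [N = 2^k], two low values would give [F < eta N] at one end and [F > (2 - eta) N] at the
   other, a rise of more than [2 (1 - eta) N], while at most [2 N cos (pi / 4)] is possible. *)
rewrite N4 e1 ler_norml => /andP[_]; rewrite -mulr_natl; nra.
Qed.

Lemma rs_poly_crossing b k j (eta : R) : eta < 2 * sin (pi / 8) ^+ 2 ->
  sqmod_circle (rs_poly R k.+2 b) (t_ k.+2 j) < eta * (2 ^ k.+2)%:R ->
  exists s, t_ k.+2 j < s <= t_ k.+2 j.+1 /\
    sqmod_circle (rs_poly R k.+2 b) s = eta * (2 ^ k.+2)%:R.
Proof.
move=> lteta low; have high := rs_poly_grid_not_both_low lteta low.
have lejj : t_ k.+2 j <= t_ k.+2 j.+1.
  by rewrite grid_pointS lerDl divr_ge0 // mulr_ge0 // pi_ge0.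
have cF := continuous_subspaceT (A := `[t_ k.+2 j, t_ k.+2 j.+1]%classic)
  (@sqmod_circle_continuous R (rs_poly R k.+2 b)).
have [|s] := @IVT R _ _ _ (eta * (2 ^ k.+2)%:R) lejj cF.
  by rewrite ge_min le_max (ltW low) high orbT.
rewrite in_itv /= => /andP[les1 les2] es; exists s; split => //.
rewrite les2 andbT lt_neqAle les1 andbT.
(* The left end is excluded because the value there is strictly below the level; this makes the
   intervals half-open and disjoint. *)
by apply: contraTneq low => ->; rewrite es ltxx.
Qed.

Lemma grid_interval_inj k i j s : t_ k i < s <= t_ k i.+1 ->
  t_ k j < s <= t_ k j.+1 -> i = j.
Proof.
have aux a c : t_ k a < t_ k c -> (a < c)%N.
  rewrite /grid_point ltr_pM2r ?invr_gt0 ?ltr0n ?expn_gt0 // -[_ *+ a]mulr_natr -[_ *+ c]mulr_natr.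
  by rewrite ltr_pM2l ?ltr_nat // mulr_gt0 // pi_gt0.
move=> /andP[li1 li2] /andP[lj1 lj2].
have := aux _ _ (lt_le_trans li1 lj2); have := aux _ _ (lt_le_trans lj1 li2).
lia.
Qed.

Lemma rs_poly_solutions b (eta eps : R) :
  0 < eta -> eta < 2 * sin (pi / 8) ^+ 2 -> 0 < eps ->
  exists k0 : nat, forall k : nat, (k0 <= k)%N ->
    at_least_solutions ((1 - eps) * eta * (2 ^ k)%:R / 2)
      (sqmod_circle (rs_poly R k b)) (eta * (2 ^ k)%:R).
Proof.
move=> eta0 lteta eps0.
have le1 : eta / 2 <= 1 by have := cos2Dsin2 (pi / 8 : R); have := sqr_ge0 (cos (pi / 8 : R)); lra.
(* The weight divides by [2n], so the level [eta n] becomes [theta = eta / 2], and the loss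
   [eps eta / 2] leaves [(1 - eps) eta / 2]. *)
have d0 : 0 < eps * eta / 2 by rewrite divr_gt0 ?mulr_gt0.
have [k0 num] := num_below_ge (rs_poly_weight01 b) (@rs_poly_moment_cvg b) le1 d0.
exists (maxn k0 2) => -[|[|k]]; rewrite geq_max ?andbF // andbT => /num {num}.
set S := [set j : 'I_(2 ^ k.+2) | _]%SET => num.
pose v (i : 'I_#|S|) : 'I_(2 ^ k.+2) := enum_val i.
have /choice[s sP] (i : 'I_#|S|) : exists y, t_ k.+2 (v i) < y <= t_ k.+2 (v i).+1 /\
    sqmod_circle (rs_poly R k.+2 b) y = eta * (2 ^ k.+2)%:R.
  apply: rs_poly_crossing => //.
  have := enum_valP i; rewrite inE /rs_poly_weight ltr_pdivrMr ?exprn_gt0 //.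
  by rewrite exprS natrX mulrA mulfVK ?pnatr_eq0.
exists #|S|, s; split => [|i|i j [q es]].
- by apply: le_trans num; rewrite le_eqVlt; apply/orP; left; apply/eqP; field.
- by have [] := sP i.
have [[si _] [sj _]] := (sP i, sP j).
have range (l : 'I_#|S|) : t_ k.+2 (v l) < s l <= t_ k.+2 (v l).+1 ->
    0 < s l <= 2 * pi.
  move=> /andP[lo hi]; have n0 : 0 < (2 ^ k.+2)%:R :> R by rewrite ltr0n expn_gt0.
  have pi0 : 0 < 2 * pi :> R by rewrite mulr_gt0 // pi_gt0.
  rewrite (le_lt_trans _ lo) ?(le_trans hi) //.
    rewrite /grid_point ler_pdivrMr // -[_ *+ _]mulr_natr ler_pM2l // ler_nat.
    exact: ltn_ord.
  by rewrite /grid_point divr_ge0 // mulrn_wge0 // ltW.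
(* All solutions lie in [(0, 2 pi]], so congruent ones are equal. *)
have q0 : q = 0.
  have /andP[i1 i2] := range _ si; have /andP[j1 j2] := range _ sj.
  have pi0 : 0 < 2 * pi :> R by rewrite mulr_gt0 // pi_gt0.
  have : (-1)%:~R < q%:~R :> R by rewrite mulrN1z -(ltr_pM2r pi0); lra.
  have : q%:~R < 1%:~R :> R by rewrite mulr1z -(ltr_pM2r pi0); lra.
  by rewrite ltr_int => q_lt1; rewrite ltr_int; move: q_lt1; clear; lia.
move: es; rewrite q0 mul0r addr0 => es; rewrite es in si.
exact/enum_val_inj/ord_inj/(grid_interval_inj si sj).
Qed.

End Solutions.

Theorem theorem2p5 (R : realType) (Rk : nat -> R -> R)
  (hRk : (forall k t, Rk k t = sqmod_circle (rsP R[i] k) t) \/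
         (forall k t, Rk k t = sqmod_circle (rsQ R[i] k) t)) :
  let n (k : nat) : R := (2 ^ k)%N%:R in
  let gamma : R := sin (pi / 8) ^+ 2 in
  (forall eta eps : R, 0 < eta -> eta < 2 * gamma -> 0 < eps ->
     exists k0 : nat, forall k : nat, (k0 <= k)%N ->
       at_least_solutions ((1 - eps) * eta * n k / 2) (Rk k) (eta * n k)) /\
  (forall eta eps : R, 2 - gamma < eta -> eta < 2 -> 0 < eps ->
     exists k0 : nat, forall k : nat, (k0 <= k)%N ->
       at_least_solutions ((1 - eps) * (2 - eta) * n k / 2)
         (Rk k) (eta * n k)).
Proof.
move=> n gamma.
have [b eRk] : exists b, forall k, Rk k = sqmod_circle (rs_poly R k b).
  by case: hRk => h; [exists false | exists true] => k; apply/funext => t; exact: h.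
split=> eta eps.
  move=> eta0 lteta eps0; have [k0 sol] := rs_poly_solutions b eta0 lteta eps0.
  by exists k0 => k /sol; rewrite eRk.
move=> lteta eta2 eps0.
have gamma0 : 0 <= gamma by exact: sqr_ge0.
(* The companion polynomial takes the value [(2 - eta) n] exactly where [R_k] takes [eta n], and
   [2 - eta < gamma <= 2 gamma]. *)
have [||k0 sol] := @rs_poly_solutions R (~~ b) (2 - eta) eps _ _ eps0.
- by rewrite subr_gt0.
- by rewrite -/gamma; lra.
exists k0 => k /sol[m [s [lem es inj]]]; exists m, s; split => // i.
have := es i; rewrite sqmod_rs_polyN eRk exprS -natrX -/(n k) => e; lra.
Qed.
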